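(* Let $p,c>0$, $\alpha\in\mathbb{R}$, let $\ell$ be a normalized slowly varying function at infinity, and let $F$ be a distribution function on $\mathbb{R}_+$, absolutely continuous for large arguments, such that for all sufficiently large $x$ $$1-F(x)=\ell(x)x^{\alpha}e^{-cx^{p}}.$$ Let $M_n$ be the maximum of $n$ i.i.d. random variables with distribution function $F$. Put $b_n=F^{\leftarrow}(1-n^{-1})$, $a_n=f(b_n)$ with $f(t)=\frac{1}{cp}t^{1-p}$, and $\gamma_n(x)=-\log\frac{1-F(b_n+a_nx)}{1-F(b_n)}$. Then for any $x\in\mathbb{R}$, as $n\to\infty$, $$P(M_n\le a_nx+b_n)-\exp\left(-e^{-x}\right)=\exp\left(-e^{-x}\right)e^{-x}(\gamma_n(x)-x)(1+o(1))+O(n^{-1}),$$ where $$\gamma_n(x)-x=\left(\frac{(p-1)x^{2}}{2}-\alpha x+o(1)\right)\frac{1}{p\log n}.$$ Moreover, the limit relation $\lim_{n\to\infty}P(M_n\le \tilde a_nx+\tilde b_n)=\exp(-e^{-x})$, $x\in\mathbb{R}$, holds with the normalizing constants $$\tilde a_n=\frac{1}{cp}\left(\frac1c\log n\right)^{1/p-1},$$ $$\tilde b_n=\left(c^{-1}\log n\right)^{1/p}+\frac1p\left(c^{-1}\log n\right)^{1/p-1}\left(\frac{\alpha}{pc}\log\left(c^{-1}\log n\right)+c^{-1}\log\ell\left((c^{-1}\log n)^{1/p}\right)\right).$$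
   Context: $F^{\leftarrow}(y)=\inf\{x: F(x)\ge y\}$ is the generalized inverse. A slowly varying function $\ell$ is normalized if, for some $x_0$, some constant $c_0>0$ and some function $\delta$ with $\delta(t)\to0$ as $t\to\infty$, one has $\ell(x)=c_0\exp\left(\int_{x_0}^{x}\delta(t)/t\,dt\right)$ for all $x\ge x_0$. *)

(* Defs.v *)
From HB Require Import structures.
From mathcomp Require Import all_boot all_order all_algebra.
From mathcomp Require Import finmap.
From mathcomp Require Import all_classical all_reals all_analysis.

Set Implicit Arguments.
Unset Strict Implicit.
Unset Printing Implicit Defensive.

Import Order.TTheory GRing.Theory Num.Theory.
Import numFieldNormedType.Exports.

Local Open Scope classical_set_scope.
Local Open Scope ring_scope.

(* The function only matters near +oo; its values elsewhere are arbitrary. *)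
Definition slowly_varying (R : realType) (l : R -> R) : Prop :=
  (exists x0 : R, measurable_fun `[x0, +oo[ l /\
     forall x, x0 <= x -> 0 < l x) /\
  (forall k : R, 0 < k -> (l (k * x) / l x) @[x --> +oo%R] --> (1 : R)).

(* The integrability clause keeps the integral from taking its default value;
   it is implicit in writing the representation. *)
Definition normalized_slowly_varying (R : realType) (l : R -> R) : Prop :=
  slowly_varying l /\
  exists (x0 c0 : R) (delta : R -> R),
    [/\ 0 < c0,
        delta t @[t --> +oo%R] --> (0 : R),
        forall x, x0 <= x ->
          (@lebesgue_measure R).-integrable `[x0, x]
            (fun t => (delta t / t)%:E) &
        forall x, x0 <= x ->
          l x = c0 * expR (\int[@lebesgue_measure R]_(t in `[x0, x])
                             (delta t / t))].

(* Absolute continuity of a distribution function on some half-line: it is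
   there the indefinite Lebesgue integral of a density. *)
Definition abs_continuous_near_infty (R : realType) (F : R -> R) : Prop :=
  exists (x0 : R) (g : R -> R), forall x, x0 <= x ->
    (@lebesgue_measure R).-integrable `[x0, x] (EFin \o g) /\
    F x = F x0 + \int[@lebesgue_measure R]_(t in `[x0, x]) g t.

Definition mutually_independent d (T : measurableType d) (R : realType)
    (P : probability T R) (X : nat -> {RV P >-> R}) : Prop :=
  forall (I : {fset nat}) (B : nat -> set R), (forall i, measurable (B i)) ->
    P (\bigcap_(i in [set` I]) (X i @^-1` B i)) =
    (\prod_(i <- I) P (X i @^-1` B i))%E.

Definition iid_with_cdf d (T : measurableType d) (R : realType)
    (P : probability T R) (X : nat -> {RV P >-> R}) (F : R -> R) : Prop :=
  mutually_independent X /\ forall i x, cdf (X i) x = (F x)%:E.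

(* For n = 0 this is X 0; for n > 0 the default value X 0 is one of the n
   variables, so this is max(X 0, ..., X (n - 1)). *)
Definition sample_max d (T : measurableType d) (R : realType)
    (P : probability T R) (X : nat -> {RV P >-> R}) (n : nat) (w : T) : R :=
  \big[Num.max/X 0%N w]_(i < n) X i w.

Definition cdf_max d (T : measurableType d) (R : realType)
    (P : probability T R) (X : nat -> {RV P >-> R}) (n : nat) (u : R) : R :=
  fine (P [set w | sample_max X n w <= u]).

(* [inf] is the real infimum: for a distribution function vanishing on the
   negative half-line it is the true one when 0 < y < 1. *)
Definition gen_inverse (R : realType) (F : R -> R) (y : R) : R :=
  inf [set x | y <= F x].

Definition aux_f (R : realType) (p c t : R) : R := (c * p)^-1 * t `^ (1 - p).

Definition loc_b (R : realType) (F : R -> R) (n : nat) : R :=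
  gen_inverse F (1 - n%:R^-1).

Definition scale_a (R : realType) (p c : R) (F : R -> R) (n : nat) : R :=
  aux_f p c (loc_b F n).

Definition gamma_n (R : realType) (p c : R) (F : R -> R) (n : nat) (x : R) : R :=
  - ln ((1 - F (loc_b F n + scale_a p c F n * x)) / (1 - F (loc_b F n))).

Definition scale_a_tilde (R : realType) (p c : R) (n : nat) : R :=
  (c * p)^-1 * (c^-1 * ln n%:R) `^ (p^-1 - 1).

Definition loc_b_tilde (R : realType) (p c alpha : R) (l : R -> R) (n : nat)
    : R :=
  let y := c^-1 * ln n%:R in
  y `^ p^-1 +
  p^-1 * y `^ (p^-1 - 1) *
    (alpha / (p * c) * ln y + c^-1 * ln (l (y `^ p^-1))).

Definition gumbel (R : realType) (x : R) : R := expR (- expR (- x)).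

(* Main.v *)
Require Import Defs.
From HB Require Import structures.
From mathcomp Require Import all_boot all_order all_algebra.
From mathcomp Require Import finmap ring lra.
From mathcomp Require Import all_classical all_reals all_analysis.

Set Implicit Arguments.
Unset Strict Implicit.
Unset Printing Implicit Defensive.

Import Order.TTheory GRing.Theory Num.Theory.
Import numFieldNormedType.Exports.

Local Open Scope classical_set_scope.
Local Open Scope ring_scope.

(** Everything is read off the negative logarithm of the tail,
    [H u = - ln (1 - F u) = c u^p - alpha ln u - ln (l u)] for large [u].
    Put [s = 1 / (c p u^p)], so that [aux_f p c u = u s].  Second-order Taylor
    expansion of [(1 + h)^p], first-order expansion of [ln (1 + h)], and the
    fact that [ln l] varies by at most [eps * ln (v / u)] between large [u] and
    [v] (the integral representation with a small [delta]) give
      [H (u + aux_f u * w) = H u + w + s ((p-1)/2 w^2 - alpha w) + o(s (w^2 + |w|))]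
    uniformly in [w] as long as [s w] is small ([neglog_tail_expansion]).  Two
    choices of [u] and [w] give the theorem.

    For the constants [a_n], [b_n], take [u = b_n] and [w = x].  As [F] is
    continuous near infinity, [F b_n = 1 - 1/n], that is [H b_n = ln n]; hence
    [gamma_n x = H (b_n + a_n x) - H b_n], and
    [p s (H b_n) -> 1] turns the scale [s] into [1 / (p ln n)]
    ([gamma_second_order]).

    For the explicit constants, take [u = (ln n / c)^(1/p)] and [w = x + K u],
    where [K u = alpha ln u + ln (l u) = c u^p - H u] is what keeps [H u] from
    being [ln n]: the second summand of the centring constant is exactly
    [aux_f u * K u].  Since [K] grows logarithmically, [s w^2 -> 0], so that
    [H (u + aux_f u * w) = H u + x + K u + o(1) = ln n + x + o(1)]
    ([cdf_pow_tilde]).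

    In both cases the distribution function of the maximum is [F^n] at a point
    where [1 - F = e^(-tau_n) / n] with [tau_n -> x].  Replacing
    [(1 - e^(-tau_n) / n)^n] by the Gumbel value at [tau_n] costs [O(1/n)]
    ([pow_gumbel_eqO]); the differentiability of the Gumbel distribution
    function at [x], with [tau_n = gamma_n x], then gives the main term
    ([gumbel_first_order]). *)

(** * Taylor expansions with Peano remainder *)

Lemma taylor1_peano (R : realType) (f : R -> R) (a m : R) :
  is_derive a 1 f m -> forall eps, 0 < eps ->
  \forall h \near 0, `|f (a + h) - f a - m * h| <= eps * `|h|.
Proof.
move=> [df <-] eps e0.
have /cvgrPdist_le /(_ eps e0) :
    (h^-1 *: ((f \o shift a) (h *: 1) - f a)) @[h --> 0^'] --> 'D_1 f a.
  exact: df.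
rewrite near_withinE; apply: filterS => h H.
have [->|h0] := eqVneq h 0; first by rewrite addr0 subrr mulr0 subr0 !normr0 mulr0.
have := H h0; rewrite /= /GRing.scale/= mulr1 (addrC h) => {}H.
rewrite distrC.
have -> : 'D_1 f a * h - (f (a + h) - f a) =
    ('D_1 f a - h^-1 * (f (a + h) - f a)) * h by field.
by rewrite normrM ler_wpM2r.
Qed.

(** Avoids the distinction between positive and negative
    increments in the remainder estimate below. *)
Lemma MVT_ball (R : realType) (f df : R -> R) (a h : R) :
  (forall x, `|x - a| <= `|h| -> is_derive x 1 f (df x)) ->
  exists2 x, `|x - a| <= `|h| & f (a + h) - f a = df x * h.
Proof.
move=> H.
have mvt (y z : R) : (forall x : R, x \in `[y, z] -> is_derive x 1 f (df x)) ->
    y <= z -> exists2 x, x \in `[y, z]%R & f z - f y = df x * (z - y).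
  move=> D yz.
  have Doo x : x \in `]y, z[%R -> is_derive x 1 f (df x).
    by move=> xyz; apply: D; exact: subset_itv_oo_cc.
  have C : {within `[y, z], continuous f}.
    by apply: derivable_within_continuous => x /D[].
  exact: MVT_segment yz Doo C.
have [h0|h0] := leP 0 h.
- have [||x xin E] := mvt a (a + h).
  + move=> x; rewrite in_itv/= => /andP[? ?]; apply: H.
    by rewrite !ger0_norm; lra.
  + lra.
  exists x; last by rewrite E; congr (_ * _); ring.
  move: xin; rewrite in_itv/= => /andP[? ?].
  by rewrite !ger0_norm; lra.
- have [||x xin E] := mvt (a + h) a.
  + move=> x; rewrite in_itv/= => /andP[? ?]; apply: H.
    by rewrite !ler0_norm; lra.
  + lra.
  exists x; last by rewrite -[LHS]opprB E; ring.
  move: xin; rewrite in_itv/= => /andP[? ?].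
  by rewrite !ler0_norm; lra.
Qed.

(** The derivative of the remainder is [f' x - f' a - m (x - a)], which the
    first-order expansion of [f'] bounds by [eps * `|x - a|]; one application of
    the mean value theorem yields the missing factor [h]. *)
Lemma taylor2_peano (R : realType) (f f' : R -> R) (a m : R) :
  (\forall x \near (a : R), is_derive (x : R) 1 f (f' x)) -> is_derive a 1 f' m ->
  forall eps, 0 < eps ->
  \forall h \near 0,
    `|f (a + h) - f a - f' a * h - m / 2 * h ^+ 2| <= eps * h ^+ 2.
Proof.
move=> Df Df' eps e0.
have [e1 /= e1_gt0 Hf] := Df.
have [e2 /= e2_gt0 Hf'] := taylor1_peano Df' e0.
have e_gt0 : 0 < Num.min e1 e2 by rewrite lt_min e1_gt0.
exists (Num.min e1 e2) => // h; rewrite /= sub0r normrN lt_min => /andP[he1 he2].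
pose g x := f x - f' a * (x - a) - m / 2 * (x - a) ^+ 2.
have [|x xh] := @MVT_ball _ g (fun x => f' x - f' a - m * (x - a)) a h.
  move=> x xh.
  have Dfx : is_derive x 1 f (f' x).
    by apply: Hf; rewrite /= distrC; exact: le_lt_trans he1.
  rewrite /g; apply: is_derive_eq.
  by rewrite /GRing.scale/=; field.
move=> E.
have -> : f (a + h) - f a - f' a * h - m / 2 * h ^+ 2 = g (a + h) - g a.
  by rewrite /g; field.
rewrite E normrM -(real_normK (num_real h)) expr2 mulrA ler_wpM2r//.
have := Hf' (x - a); rewrite /= sub0r normrN subrKC => /(_ (le_lt_trans xh he2)).
by move=> /le_trans; apply; rewrite ler_wpM2l// ltW.
Qed.

(** * Slow variation on the logarithmic scale *)

Section slow.
Variable R : realType.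
Implicit Types (l L : R -> R).
Notation mu := (@lebesgue_measure R).

Lemma Rintegral_inv (a b : R) : 0 < a -> a <= b ->
  mu.-integrable `[a, b] (EFin \o (fun t => t^-1)) /\
  \int[mu]_(t in `[a, b]) t^-1 = ln b - ln a.
Proof.
move=> a0 ab.
have inab x : x \in `[a, b] -> 0 < x.
  by rewrite in_itv/= => /andP[ax _]; exact: lt_le_trans ax.
have cinv : {within `[a, b], continuous (fun t : R => t^-1)}.
  apply: continuous_in_subspaceT => x /set_mem/= /inab x0.
  by apply: inv_continuous; rewrite gt_eqF.
split; first by apply: continuous_compact_integrable => //; exact: segment_compact.
move: ab; rewrite le_eqVlt => /orP[/eqP <-|ab].
  by rewrite set_itv1 Rintegral_set1 subrr.
rewrite /Rintegral (@continuous_FTC2 _ _ (@ln R))//.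
  split => [x xab||].
  - have [] // := @is_derive1_ln R x (inab _ (subset_itv_oo_cc xab)).
  - apply: cvg_at_right_filter; exact: continuous_ln.
  - apply: cvg_at_left_filter; apply: continuous_ln; exact: lt_trans ab.
move=> x xab; rewrite derive1E.
by have [] := @is_derive1_ln R x (inab _ (subset_itv_oo_cc xab)).
Qed.

(** The additive, quantitative form of the representation of a normalized
    slowly varying function [expR \o L]: the index of variation of [L] with
    respect to [ln] tends to [0], uniformly over all pairs [u <= v]. *)
Definition log_slow L := forall eps, 0 < eps -> exists2 U, 0 < U &
  forall u v, U <= u -> u <= v -> `|L v - L u| <= eps * (ln v - ln u).

(** [ln (l v) - ln (l u)] is the integral of [delta t / t] over
    [[u, v]]; once [`|delta| <= eps] there, it is dominated by the integral of
    [eps / t]. *)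
Lemma nsv_log_slow l : normalized_slowly_varying l ->
  (\forall x \near +oo, 0 < l x) /\ log_slow (fun x => ln (l x)).
Proof.
move=> [_ [x0 [c0 [delta [c0_gt0 delta0 dint lE]]]]].
split.
  near=> x; rewrite lE; first by rewrite mulr_gt0// expR_gt0.
  near: x; apply: nbhs_pinfty_ge; exact: num_real.
move=> eps e0.
have /cvgrPdist_le/(_ eps e0)[U [_ HU]] := delta0.
pose V := Num.max (Num.max x0 (U + 1)) 1.
exists V => [|u v Vu uv]; first by rewrite !lt_max ltr01 orbT.
have [x0u Uu u0] : [/\ x0 <= u, U < u & 0 < u].
  move: Vu; rewrite !ge_max => /andP[/andP[-> h1] h2].
  split => //; lra.
have x0v := le_trans x0u uv.
rewrite /= !lE//.
rewrite !lnM ?posrE ?expR_gt0// !expRK opprD addrACA subrr add0r.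
have idv := dint _ x0v.
have sub : `[u, v] `<=` `[x0, v].
  by apply: subset_itvr; rewrite bnd_simp.
have sub' : `]u, v] `<=` `[u, v] by apply: subset_itvr; rewrite bnd_simp.
have idu : mu.-integrable `[u, v] (EFin \o (fun t => delta t / t)).
  exact: integrableS idv.
rewrite Rintegral_itvB ?bnd_simp//.
rewrite Rintegral_itv_obnd_cbnd//; last exact: integrableS idu.
have [iinv <-] := Rintegral_inv u0 uv.
rewrite -RintegralZl//.
apply: (le_trans (le_normr_Rintegral _ _)) => //.
apply: le_Rintegral => //.
- have := integrable_abse idu; exact.
- have := integrableZl _ eps iinv; exact.
- move=> t /=; rewrite in_itv/= => /andP[ut tv].
  have t0 : 0 < t by exact: lt_le_trans ut.
  have it0 : 0 <= t^-1 by rewrite invr_ge0 ltW.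
  rewrite normrM [X in _ * X]ger0_norm// ler_wpM2r//.
  have := HU t (lt_le_trans Uu ut).
  by rewrite sub0r normrN.
Unshelve. all: by end_near. Qed.

Lemma log_slow_continuous L : log_slow L ->
  \forall u \near +oo, {for u, continuous L}.
Proof.
move=> /(_ 1 ltr01)[U U0 HL].
exists U; split=> [|u Uu]; first exact: num_real.
have u0 : 0 < u by exact: lt_trans Uu.
apply/cvgrPdist_le => eps e0.
have /cvgrPdist_le/(_ eps e0) := continuous_ln u0.
have : \forall v \near u, U < v by exact: (cvgr_gt u cvg_id).
apply: filterS2 => v Uv; apply: le_trans.
wlog uv : u v {u0} Uu Uv / u <= v.
  move=> W; have [/W|/ltW/W H] := leP u v; first exact.
  by rewrite distrC [leRHS]distrC; exact: H.
rewrite distrC [leRHS]distrC [leRHS]ger0_norm.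
  by apply: le_trans (HL _ _ (ltW Uu) uv) _; rewrite mul1r.
by rewrite subr_ge0 ler_ln ?posrE//; [exact: lt_trans Uu|exact: lt_trans Uv].
Qed.

(** The crude case [eps = 1]; it suffices for comparing [L] with powers. *)
Lemma log_slow_ln_bound L : log_slow L ->
  exists C, \forall u \near +oo, `|L u| <= C + ln u.
Proof.
move=> /(_ 1 ltr01)[U U0 HL].
exists (`|L U| - ln U); near=> u.
have Uu : U <= u by near: u; apply: nbhs_pinfty_ge; exact: num_real.
have := HL _ _ (lexx _) Uu; rewrite mul1r => H.
have := lerB_dist (L u) (L U). lra.
Unshelve. all: by end_near. Qed.

End slow.

(** * Local expansion of the negative log-tail *)

(** [- ln (expR (L u) * u `^ alpha * expR (- (c * u `^ p)))]. *)
Definition neglog_tail (R : realType) (p c alpha : R) (L : R -> R) (u : R) : R :=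
  c * u `^ p - alpha * ln u - L u.

(** The relative size [aux_f p c u / u] of the scale at [u]. *)
Definition rel_scale (R : realType) (p c u : R) : R := (c * p * u `^ p)^-1.

Section expansion.
Variables (R : realType) (p c alpha : R).
Hypotheses (p_gt0 : 0 < p) (c_gt0 : 0 < c).
Notation s := (rel_scale p c).

Lemma rel_scale_gt0 u : 0 < u -> 0 < s u.
Proof. by move=> u0; rewrite invr_gt0 !mulr_gt0// powR_gt0. Qed.

Lemma aux_fE u : 0 < u -> aux_f p c u = u * s u.
Proof.
move=> u0; rewrite /aux_f /rel_scale powRB; last by rewrite (gt_eqF u0) implybT.
rewrite powRr1 ?ltW//; field.
by rewrite !gt_eqF ?powR_gt0.
Qed.

Lemma powR1D_taylor2 (eps : R) : 0 < eps ->
  \forall h \near 0, `|(1 + h) `^ p - 1 - p * h - p * (p - 1) / 2 * h ^+ 2|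
     <= eps * h ^+ 2.
Proof.
move=> e0.
have D (q x : R) : 0 < x -> is_derive x 1 ((@powR R) ^~ q) (q * x `^ (q - 1)).
  by move=> x0; exact: is_derive1_powR.
have near1 : \forall x \near (1 : R), is_derive (x : R) 1 ((@powR R) ^~ p) (p * x `^ (p - 1)).
  have : \forall x \near (1 : R), (0 : R) < x by apply: (cvgr_gt (1 : R) cvg_id).
  by apply: filterS => x x0; exact: D.
have D1 : is_derive (1 : R) 1 (fun x => p * x `^ (p - 1)) (p * (p - 1)).
  have := D (p - 1) 1 ltr01; rewrite powR1 mulr1 => D1.
  by apply: is_derive_eq; rewrite /GRing.scale/=; ring.
have := taylor2_peano near1 D1 e0; apply: filterS => h.
by rewrite !powR1 mulr1.
Qed.

Lemma ln1D_taylor1 (eps : R) : 0 < eps ->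
  \forall h \near 0, `|ln (1 + h) - h| <= eps * `|h| :> R.
Proof.
move=> e0; have := taylor1_peano (@is_derive1_ln R 1 ltr01) e0.
by apply: filterS => h; rewrite ln1 invr1 mul1r subr0.
Qed.

(** With [h = s u * w] the argument is [u (1 + h)], and each of the three terms
    of [neglog_tail] is expanded in [h].  As [c * u `^ p = (p * s u)^-1], the
    term [p h] of [(1 + h) `^ p] becomes exactly [w] and its error
    [eps p h^2] becomes [eps * s u * w ^+ 2]; the errors of the logarithm and of
    [L] are linear in [h], hence the summand [`|w|]. *)
Lemma neglog_tail_expansion L : log_slow L -> forall eps, 0 < eps ->
  exists U eta, [/\ 0 < U, 0 < eta <= 2^-1 & forall u w, U <= u -> `|s u * w| <= eta ->
    `|neglog_tail p c alpha L (u + aux_f p c u * w) - neglog_tail p c alpha L u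
      - (w + s u * ((p - 1) / 2 * w ^+ 2 - alpha * w))|
    <= eps * s u * (w ^+ 2 + `|w|)].
Proof.
move=> Lslow eps e0.
have [k [k_gt0 k_le1 k_le]] :
    exists k : R, [/\ 0 < k, k <= 1 & k <= eps / 2 / (`|alpha| + 1)].
  exists (Num.min 1 (eps / 2 / (`|alpha| + 1))).
  rewrite lt_min ltr01/= !divr_gt0 ?ltr_wpDl//.
  by split => //; rewrite ge_min lexx ?orbT.
have [e1 /= e1_gt0 H1] := powR1D_taylor2 (mulr_gt0 e0 p_gt0).
have [e2 /= e2'_gt0 H2] := ln1D_taylor1 k_gt0.
have [|U U0 HL] := Lslow (eps / 4); first by rewrite divr_gt0.
(* Doubling [U] leaves room for [u * (1 + h)] with [h >= - 1 / 2]. *)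
exists (2 * U), (Num.min 2^-1 (Num.min (e1 / 2) (e2 / 2))).
split; first by rewrite mulr_gt0.
  by rewrite !lt_min !divr_gt0// invr_gt0 ltr0n ge_min lexx.
move=> u w Uu; rewrite !le_min => /andP[h12 /andP[he1 he2]].
have u0 : 0 < u by apply: lt_le_trans Uu; rewrite mulr_gt0.
have s0 := rel_scale_gt0 u0.
set h := s u * w in h12 he1 he2 *.
have wE : w = h / s u by rewrite /h mulrC mulKf// gt_eqF.
have vE : u + aux_f p c u * w = u * (1 + h) by rewrite aux_fE// /h; ring.
have hb : - (2^-1) <= h <= 2^-1 by rewrite -ler_norml.
have h1 : 0 < 1 + h by lra.
have Uv : U <= u * (1 + h).
  have : u * 2^-1 <= u * (1 + h) by rewrite ler_pM2l//; lra.
  by apply: le_trans; lra.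
have Uu' : U <= u by lra.
have lnv : ln (u * (1 + h)) = ln u + ln (1 + h) by rewrite lnM.
have /H1 E1 : ball_ Num.norm 0 e1 h by rewrite /= sub0r normrN; lra.
have /H2 E2 : ball_ Num.norm 0 e2 h by rewrite /= sub0r normrN; lra.
have E2a : `|ln (1 + h)| <= 2 * `|h|.
  have := le_trans E2 (ler_wpM2r (normr_ge0 _) k_le1).
  have := ler_normD (ln (1 + h) - h) h; rewrite subrK; lra.
have E2b : `|alpha| * `|ln (1 + h) - h| <= eps / 2 * `|h|.
  have := le_trans E2 (ler_wpM2r (normr_ge0 _) k_le).
  move=> H; apply: le_trans (ler_wpM2l (normr_ge0 _) H) _.
  rewrite mulrA ler_wpM2r// mulrCA ler_piMr//; first by rewrite divr_ge0// ltW.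
  by rewrite ler_pdivrMr ?ltr_wpDl// mul1r lerDl.
have e4_ge0 : 0 <= eps / 4 by rewrite divr_ge0// ltW.
have E3 : `|L (u * (1 + h)) - L u| <= eps / 2 * `|h|.
  have : `|L (u * (1 + h)) - L u| <= eps / 4 * `|ln (1 + h)|.
    (* [L] is only controlled for ordered pairs, so the sign of [h] matters. *)
    have [uv|vu] := leP u (u * (1 + h)).
    - have := HL _ _ Uu' uv; rewrite lnv addrAC subrr add0r.
      by move=> /le_trans; apply; rewrite ler_wpM2l// ler_norm.
    - have := HL _ _ Uv (ltW vu); rewrite lnv opprD addrA subrr add0r distrC.
      move=> /le_trans; apply; rewrite ler_wpM2l//.
      by rewrite -normrN ler_norm.
  move=> /le_trans; apply.
  apply: le_trans (ler_wpM2l e4_ge0 E2a) _.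
  by rewrite !mulrA ler_wpM2r//; lra.
have cuE : c * u `^ p = (p * s u)^-1.
  rewrite /rel_scale; field; rewrite !gt_eqF ?powR_gt0//.
rewrite vE /neglog_tail lnv powRM ?(ltW u0) ?(ltW h1)//.
pose T1 := (1 + h) `^ p - 1 - p * h - p * (p - 1) / 2 * h ^+ 2.
have -> : c * (u `^ p * (1 + h) `^ p) - alpha * (ln u + ln (1 + h)) - L (u * (1 + h))
   - (c * u `^ p - alpha * ln u - L u)
   - (w + s u * ((p - 1) / 2 * w ^+ 2 - alpha * w)) =
   (p * s u)^-1 * T1 - alpha * (ln (1 + h) - h) - (L (u * (1 + h)) - L u).
  rewrite /T1 mulrA cuE wE; field.
  by rewrite !gt_eqF.
have T1b : `|(p * s u)^-1 * T1| <= eps * s u * w ^+ 2.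
  have i0 : 0 <= (p * s u)^-1 by rewrite invr_ge0 mulr_ge0// ltW.
  rewrite normrM ger0_norm//; apply: le_trans (ler_wpM2l i0 E1) _.
  rewrite /h le_eqVlt; apply/orP; left; apply/eqP; field.
  by rewrite !gt_eqF.
apply: le_trans (ler_normB _ _) _.
have -> : eps * s u * (w ^+ 2 + `|w|) =
    eps * s u * w ^+ 2 + eps / 2 * `|h| + eps / 2 * `|h|.
  by rewrite /h normrM (gtr0_norm s0); field.
apply: lerD E3; apply: le_trans (ler_normB _ _) _.
by apply: lerD T1b _; rewrite normrM.
Qed.

End expansion.

(** * Limits at infinity of the negative log-tail *)

Section limits.
Variable R : realType.

Lemma cvg0_le (T : Type) (F : set_system T) {FF : Filter F} (f g : T -> R) :
  (\forall x \near F, `|f x| <= g x) -> g x @[x --> F] --> (0 : R) ->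
  f x @[x --> F] --> (0 : R).
Proof.
move=> fg /cvgr0Pnorm_le g0; apply/cvgr0Pnorm_le => eps /g0.
by apply: filterS2 fg => x fg /(le_trans (ler_norm _)); exact: le_trans.
Qed.

Lemma powR_cvgy (q : R) : 0 < q -> u `^ q @[u --> +oo] --> +oo.
Proof.
move=> q0; apply/cvgryPge => A; near=> u.
have uA : Num.max A 1 `^ q^-1 <= u by near: u; apply: nbhs_pinfty_ge; exact: num_real.
have A0 : 0 <= Num.max A 1 by rewrite le_max ler01 orbT.
apply: (@le_trans _ _ ((Num.max A 1 `^ q^-1) `^ q)).
  by rewrite -powRrM mulVf ?gt_eqF// powRr1// le_max lexx.
by apply: ge0_ler_powR; rewrite ?nnegrE ?powR_ge0 ?(ltW q0)// (le_trans _ uA)// powR_ge0.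
Unshelve. all: by end_near. Qed.

Lemma powRN_cvg0 (q : R) : 0 < q -> u `^ (- q) @[u --> +oo] --> (0 : R).
Proof.
move=> q0; apply/cvgr0Pnorm_le => eps e0.
have /cvgryPge/(_ eps^-1) := powR_cvgy q0; apply: filterS => u H.
have ie0 : 0 < eps^-1 by rewrite invr_gt0.
rewrite powRN ger0_norm ?invr_ge0 ?powR_ge0// -[leRHS]invrK.
by rewrite lef_pV2 ?posrE// (lt_le_trans ie0).
Qed.

Variables (p c alpha : R).
Hypotheses (p_gt0 : 0 < p) (c_gt0 : 0 < c).
Notation s := (rel_scale p c).

Lemma rel_scaleE u : s u = (c * p)^-1 * u `^ (- p).
Proof. by rewrite /rel_scale invfM powRN. Qed.

Lemma rel_scale_cvg0 : s u @[u --> +oo] --> (0 : R).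
Proof.
under eq_fun do rewrite rel_scaleE.
by rewrite -(mulr0 (c * p)^-1); apply: cvgMl_tmp; exact: powRN_cvg0.
Qed.

Variable L : R -> R.
Hypothesis Lslow : log_slow L.
Notation H := (neglog_tail p c alpha L).
Notation K u := (alpha * ln u + L u).

(** [alpha * ln u + L u] is [O(ln u)], hence [O(u `^ (p / 4))], and its square
    is negligible against [u `^ p]. *)
Lemma rel_scale_log_sq_cvg0 x : s u * (x + K u) ^+ 2 @[u --> +oo] --> (0 : R).
Proof.
have [C HC] := log_slow_ln_bound Lslow.
pose D := `|x| + `|C| + (`|alpha| + 1) * (4 / p).
(* Any exponent below [p / 2] would do: [u `^ q] squared against [u `^ p]. *)
pose q := p / 4.
have q0 : 0 < q by rewrite divr_gt0.
apply: (@cvg0_le _ _ _ _ (fun u => (c * p)^-1 * D ^+ 2 * u `^ (- (p / 2)))); last first.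
  rewrite -(mulr0 ((c * p)^-1 * D ^+ 2)); apply: cvgMl_tmp.
  by apply: powRN_cvg0; rewrite divr_gt0.
near=> u.
have u1 : 1 <= u by near: u; apply: nbhs_pinfty_ge; exact: num_real.
have u0 : 0 < u by exact: lt_le_trans u1.
have Lu : `|L u| <= C + ln u by near: u.
have s0 := rel_scale_gt0 p_gt0 c_gt0 u0.
have uq0 : 0 < u `^ q by rewrite powR_gt0.
have uq1 : 1 <= u `^ q by rewrite -(powRr0 u) ler_powR// ltW.
have lnu0 : 0 <= ln u by exact: ln_ge0.
have lnu : ln u <= 4 / p * u `^ q.
  have := ltW (ln_sublinear uq0); rewrite ln_powR /q => lnq.
  have ip : 0 <= 4 / p by rewrite divr_ge0// ltW.
  have := ler_wpM2l ip lnq; rewrite mulrA.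
  by rewrite (_ : 4 / p * (p / 4) = 1) ?mul1r//; field; rewrite gt_eqF.
have Kb : `|x + K u| <= D * u `^ q.
  have := ler_normD x (K u); have := ler_normD (alpha * ln u) (L u).
  rewrite normrM (ger0_norm lnu0) => h1 h2.
  have h3 := ler_norm C.
  have h4 := ler_wpM2l (normr_ge0 alpha) lnu.
  have h5 := ler_wpM2l (normr_ge0 x) uq1.
  have h6 := ler_wpM2l (normr_ge0 C) uq1.
  rewrite /D !mulrDl; lra.
rewrite normrM (gtr0_norm s0) normrX rel_scaleE.
have -> : u `^ (- p) = u `^ (- (p / 2)) / (u `^ q) ^+ 2.
  rewrite -powR_mulrn ?ltW// -powRrM -powRB.
    by congr (_ `^ _); rewrite /q; field.
  by rewrite (gt_eqF u0) implybT.
have icp : 0 <= (c * p)^-1 by rewrite invr_ge0 mulr_ge0// ltW.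
rewrite -!mulrA ler_wpM2l//.
have -> : D * (D * u `^ (- (p / 2))) = u `^ (- (p / 2)) * ((u `^ q) ^- 2 * (D * u `^ q) ^+ 2).
  by field; rewrite gt_eqF.
rewrite ler_wpM2l ?powR_ge0// ler_wpM2l ?invr_ge0 ?exprn_ge0 ?powR_ge0//.
by rewrite lerXn2r ?nnegrE//; exact: le_trans Kb.
Unshelve. all: by end_near. Qed.

(** The leading term [c * u `^ p] of the negative log-tail contributes exactly
    [1]; the logarithmic terms are negligible. *)
Lemma rel_scale_neglog_cvg1 : p * s u * H u @[u --> +oo] --> (1 : R).
Proof.
have h0 : p * (s u * K u) @[u --> +oo] --> (0 : R).
  rewrite -[X in _ --> X](mulr0 p); apply: cvgMl_tmp.
  apply: (@cvg0_le _ _ _ _ (fun u => s u + s u * (0 + K u) ^+ 2)); last first.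
    rewrite -[X in _ --> X]addr0; apply: cvgD; first exact: rel_scale_cvg0.
    exact: rel_scale_log_sq_cvg0.
  near=> u.
  have u0 : 0 < u by near: u; apply: nbhs_pinfty_gt; exact: num_real.
  have s0 := rel_scale_gt0 p_gt0 c_gt0 u0.
  rewrite add0r normrM (gtr0_norm s0) -[X in X + _ * _]mulr1 -mulrDr ler_pM2l//.
  rewrite -(real_normK (num_real (K u))).
  set k := `|_|; have : 0 <= k by exact: normr_ge0.
  nra.
have h1 : 1 - p * (s u * K u) @[u --> +oo] --> (1 : R).
  rewrite -[X in _ --> X]subr0; apply: cvgB => //; exact: cvg_cst.
apply: cvg_trans h1; apply: near_eq_cvg; near=> u.
have u0 : 0 < u by near: u; apply: nbhs_pinfty_gt; exact: num_real.
rewrite /neglog_tail /rel_scale; field.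
by rewrite !gt_eqF// powR_gt0.
Unshelve. all: by end_near. Qed.

(** [s w^2 -> 0] implies [s w -> 0], because [`|w| <= 1 + w^2]; this puts the
    expansion in force and makes all of its error terms vanish. *)
Lemma neglog_tail_shift (w : R -> R) : s u * w u ^+ 2 @[u --> +oo] --> (0 : R) ->
  u + aux_f p c u * w u @[u --> +oo] --> +oo /\
  H (u + aux_f p c u * w u) - H u - w u @[u --> +oo] --> (0 : R).
Proof.
move=> sw2.
have sw : s u * `|w u| @[u --> +oo] --> (0 : R).
  apply: (@cvg0_le _ _ _ _ (fun u => s u + s u * w u ^+ 2)); last first.
    by rewrite -[X in _ --> X]addr0; apply: cvgD => //; exact: rel_scale_cvg0.
  near=> u.
  have u0 : 0 < u by near: u; apply: nbhs_pinfty_gt; exact: num_real.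
  have s0 := rel_scale_gt0 p_gt0 c_gt0 u0.
  rewrite normrM normr_id (gtr0_norm s0) -[X in X + _ * _]mulr1 -mulrDr ler_pM2l//.
  rewrite -(real_normK (num_real (w u))).
  set k := `|_|; have : 0 <= k by exact: normr_ge0.
  nra.
have sw_small (eta : R) : 0 < eta -> \forall u \near +oo, `|s u * w u| <= eta.
  move=> eta0; have /cvgr0Pnorm_le /(_ eta eta0) := sw.
  by apply: filterS => u; rewrite !normrM normr_id.
split.
  apply/cvgryPge => A; near=> u.
  have u0 : 0 < u by near: u; apply: nbhs_pinfty_gt; exact: num_real.
  have uA : 2 * `|A| <= u by near: u; apply: nbhs_pinfty_ge; exact: num_real.
  have : `|s u * w u| <= 2^-1 by near: u; apply: sw_small.
  rewrite aux_fE// ler_norml => /andP[h _].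
  have := ler_wpM2l (ltW u0) h; have := ler_norm A; lra.
have [U [eta [U0 /andP[eta0 _] HU]]] :=
  neglog_tail_expansion alpha p_gt0 c_gt0 Lslow ltr01.
pose B := `|(p - 1) / 2| + 1.
apply: (@cvg0_le _ _ _ _ (fun u => B * (s u * w u ^+ 2) + (`|alpha| + 1) * (s u * `|w u|))); last first.
  rewrite -[X in _ --> X]addr0 -[X in _ --> X + _](mulr0 B).
  rewrite -[X in _ --> _ + X](mulr0 (`|alpha| + 1)).
  by apply: cvgD; apply: cvgMl_tmp.
near=> u.
have u0 : 0 < u by near: u; apply: nbhs_pinfty_gt; exact: num_real.
have Uu : U <= u by near: u; apply: nbhs_pinfty_ge; exact: num_real.
have s0 := rel_scale_gt0 p_gt0 c_gt0 u0.
have swe : `|s u * w u| <= eta by near: u; exact: sw_small.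
have := HU u (w u) Uu swe; rewrite mul1r.
set D := H _ - H u => hD.
pose E := s u * ((p - 1) / 2 * w u ^+ 2 - alpha * w u).
have hE : `|E| <= s u * (`|(p - 1) / 2| * w u ^+ 2 + `|alpha| * `|w u|).
  rewrite normrM (gtr0_norm s0) ler_pM2l//; apply: le_trans (ler_normB _ _) _.
  by rewrite (normrM ((p - 1) / 2)) (ger0_norm (sqr_ge0 (w u))) (normrM alpha).
have := ler_normD (D - (w u + E)) E.
rewrite (_ : D - (w u + E) + E = D - w u); last by ring.
rewrite -/E in hD; rewrite /B; lra.
Unshelve. all: by end_near. Qed.

(** For a fixed increment the error of the expansion is [o(s u)]. *)
Lemma neglog_tail_shift_second_order (x : R) :
  (H (u + aux_f p c u * x) - H u - x) / s u @[u --> +oo] -->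
  (p - 1) / 2 * x ^+ 2 - alpha * x.
Proof.
apply/cvgrPdist_le => eps e0.
pose B := x ^+ 2 + `|x| + 1.
have B0 : 0 < B by rewrite ltr_wpDl// addr_ge0// sqr_ge0.
have [U [eta [U0 /andP[eta0 _] HU]]] :=
  neglog_tail_expansion alpha p_gt0 c_gt0 Lslow (divr_gt0 e0 B0).
have sx : s u * x @[u --> +oo] --> (0 : R).
  by rewrite -(mul0r x); apply: cvgMr_tmp; exact: rel_scale_cvg0.
near=> u.
have u0 : 0 < u by near: u; apply: nbhs_pinfty_gt; exact: num_real.
have Uu : U <= u by near: u; apply: nbhs_pinfty_ge; exact: num_real.
have s0 := rel_scale_gt0 p_gt0 c_gt0 u0.
have sxe : `|s u * x| <= eta by near: u; move/cvgr0Pnorm_le: sx; exact.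
have := HU u x Uu sxe.
set D := H _ - H u; set T := _ - alpha * x => hD.
have -> : T - (D - x) / s u = - ((D - (x + s u * T)) / s u) by field; rewrite gt_eqF.
rewrite normrN normf_div (gtr0_norm s0) ler_pdivrMr//; apply: le_trans hD _.
rewrite -!mulrA ler_pM2l// mulrCA ler_piMr//; first exact: ltW.
by rewrite mulrC ler_pdivrMr// mul1r /B lerDl.
Unshelve. all: by end_near. Qed.

End limits.

(** * Sample maximum and quantiles *)

Section sample_maximum.
Context d (T : measurableType d) (R : realType) (P : probability T R).
Variable X : nat -> {RV P >-> R}.

Lemma sample_max_le (n : nat) (u : R) : (0 < n)%N ->
  [set w | sample_max X n w <= u] =
  \bigcap_(i in [set` [fset i in iota 0 n]%fset]) (X i @^-1` `]-oo, u]).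
Proof.
move=> n0; apply/seteqP; split=> w /=.
  move=> /bigmax_leP[_ H] i /=; rewrite in_fset mem_iota add0n in_itv/= => ltin.
  exact: (H (Ordinal ltin)).
move=> H; have Hi i : (i < n)%N -> X i w <= u.
  move=> ltin; have := H i; rewrite /= in_itv/=; apply.
  by rewrite in_fset mem_iota.
by apply/bigmax_leP; split=> [|i _]; exact: Hi.
Qed.

Lemma cdf_max_pow (F : R -> R) (n : nat) (u : R) : iid_with_cdf X F ->
  (0 < n)%N -> cdf_max X n u = F u ^+ n.
Proof.
move=> [indep Xcdf] n0; rewrite /cdf_max sample_max_le// indep; last first.
  by move=> i; exact: measurable_itv.
have PXi i : P (X i @^-1` `]-oo, u]) = (F u)%:E by rewrite -(Xcdf i).
under eq_bigr do rewrite PXi.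
have prodE (s : seq nat) : (\prod_(i <- s) (F u)%:E = (F u ^+ size s)%:E)%E.
  elim: s => [|i s IH]; first by rewrite big_nil.
  by rewrite big_cons IH /= exprS EFinM.
rewrite prodE /=; congr (_ ^+ _).
by rewrite -[LHS]/(#|` _|)%fset card_fseq undup_id ?iota_uniq// size_iota.
Qed.

End sample_maximum.

Section quantile.
Variables (R : realType) (F : cumulativeBounded (0 : R) (1 : R)).
Hypotheses (F_lt1 : \forall x \near +oo, F x < 1)
  (F_neg : forall x, x < 0 -> F x = 0)
  (F_cont : \forall x \near +oo, {for x, continuous F}).

Let F_homo : {homo F : x y / x <= y}.
Proof. exact: cumulative_is_nondecreasing. Qed.

Lemma quantile_set_lbound (n : nat) : (1 < n)%N ->
  lbound [set x | 1 - n%:R^-1 <= F x] 0.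
Proof.
move=> n1 x /=; apply: contraTT; rewrite -!ltNge => /F_neg ->.
by rewrite subr_gt0 invf_lt1 ?ltr1n// ltr0n ltnW.
Qed.

Lemma quantile_set_nonempty (n : nat) : (0 < n)%N ->
  [set x | 1 - n%:R^-1 <= F x] !=set0.
Proof.
move=> n0; have e0 : 0 < (n%:R^-1 : R) by rewrite invr_gt0 ltr0n.
have /cvgrPdist_le/(_ _ e0) [M [_ HM]] := cumulativey F.
exists (M + 1) => /=; have M1 : M < M + 1 by lra.
have := HM _ M1; rewrite ler_norml => /andP[_]; lra.
Qed.

Lemma loc_b_cvgy : loc_b F n @[n --> \oo] --> +oo.
Proof.
apply/cvgryPge => A.
have [M FM AM] : exists2 M, F M < 1 & A <= M.
  have [B [_ HB]] := F_lt1; exists (Num.max A B + 1).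
    by apply: HB; rewrite ltr_pwDr// le_max lexx orbT.
  by rewrite ler_wpDr// le_max lexx.
have d0 : 0 < 1 - F M by rewrite subr_gt0.
near=> n.
have n0 : (0 < n)%N by near: n; exact: nbhs_infty_gt.
have dn : (1 - F M)^-1 < n%:R.
  by near: n; have /cvgryPgt := @cvgr_idn R; exact.
apply: le_trans AM _; apply: lb_le_inf; first exact: quantile_set_nonempty.
move=> x /=; apply: contraTT; rewrite -!ltNge => /ltW /F_homo FxM.
apply: le_lt_trans FxM _; rewrite ltrBrDr -ltrBrDl.
by rewrite invf_plt ?posrE// ltr0n.
Unshelve. all: by end_near. Qed.

(** If [F b] exceeded the level, continuity would put points to the left of the
    infimum into the set that it bounds; if [F b] were below, monotonicity
    would keep the set away from [b]. *)
Lemma cdf_loc_b : \forall n \near \oo, F (loc_b F n) = 1 - n%:R^-1.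
Proof.
have cont : \forall n \near \oo, {for loc_b F n, continuous F}.
  exact: loc_b_cvgy F_cont.
near=> n.
have n1 : (1 < n)%N by near: n; exact: nbhs_infty_gt.
have cn : {for loc_b F n, continuous F} by near: n.
set y := 1 - n%:R^-1; set b := loc_b F n in cn *.
have lb : has_lbound [set x | y <= F x] by exists 0; exact: quantile_set_lbound.
apply/eqP; rewrite eq_le !leNgt; apply/andP; split; apply/negP => Fb.
- have [e /= e0 He] : \forall x \near b, y < F x by exact: (cvgr_gt _ cn).
  have : y < F (b - e / 2).
    by apply: He; rewrite /= opprB addrC subrK ger0_norm; lra.
  by move=> /ltW /(ge_inf lb); rewrite -/(gen_inverse F y) -/(loc_b F n) -/b; lra.
- have [e /= e0 He] : \forall x \near b, F x < y by exact: (cvgr_lt _ cn).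
  have Fe : F (b + e / 2) < y.
    by apply: He; rewrite /= opprD addrA subrr add0r normrN ger0_norm; lra.
  have : b + e / 2 <= b.
    apply: lb_le_inf; first by apply: quantile_set_nonempty; exact: ltnW.
    move=> x /=; apply: contraTT; rewrite -!ltNge => /ltW /F_homo.
    by move=> /le_lt_trans; apply.
  lra.
Unshelve. all: by end_near. Qed.

End quantile.

(** * Gumbel approximation of n-th powers *)

Section gumbel_approximation.
Variable R : realType.
Implicit Types (a b t x z : R).

(** The mean value bound for the [n]-th power on the unit interval. *)
Lemma pow_diff_le a b n : 0 <= a -> a <= b -> b <= 1 ->
  b ^+ n - a ^+ n <= n%:R * (b - a).
Proof.
move=> a0 ab b1; elim: n => [|n IH]; first by rewrite !expr0 subrr mul0r.
have b0 := le_trans a0 ab.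
have bn : 0 <= a ^+ n <= 1 by rewrite exprn_ge0// exprn_ile1// (le_trans ab).
have -> : b ^+ n.+1 - a ^+ n.+1 = b * (b ^+ n - a ^+ n) + a ^+ n * (b - a).
  by rewrite !exprS; ring.
rewrite -natr1 mulrDl mul1r lerD//.
  apply: le_trans IH; rewrite ler_piMl// subr_ge0.
  by rewrite lerXn2r ?nnegrE.
by case/andP: bn => ? ?; rewrite ler_piMl// subr_ge0.
Qed.

(** With [y = z / n], [expR (- z)] is the [n]-th power of [expR (- y)], and
    [1 - y <= expR (- y) <= (1 + y)^-1 <= 1 - y + y ^+ 2]: the bases differ by
    at most [y ^+ 2], the powers by at most [n] times that. *)
Lemma pow_expR_bound z n : (0 < n)%N -> 0 <= z <= n%:R ->
  `|(1 - z / n%:R) ^+ n - expR (- z)| <= z ^+ 2 / n%:R.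
Proof.
move=> n0 /andP[z0 zn]; have N0 : (0 : R) < n%:R by rewrite ltr0n.
set y := z / n%:R.
have y0 : 0 <= y by rewrite divr_ge0// ltW.
have y1 : y <= 1 by rewrite ler_pdivrMr// mul1r.
have ey : expR (- z) = expR (- y) ^+ n.
  by rewrite -expRM_natl /y; congr expR; field; rewrite gt_eqF.
have le1 : 1 - y <= expR (- y) by exact: expR_ge1Dx.
have le2 : expR (- y) <= 1 by rewrite expR_le1 oppr_le0.
have le3 : expR (- y) <= 1 - y + y ^+ 2.
  rewrite expRN; apply: (@le_trans _ _ (1 + y)^-1).
    by rewrite lef_pV2 ?posrE ?expR_gt0// ?expR_ge1Dx// ltr_wpDr.
  rewrite -[leLHS]mul1r ler_pdivrMr ?ltr_wpDr//.
  have : 0 <= y ^+ 3 by rewrite exprn_ge0.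
  by rewrite !exprS expr0; nra.
rewrite ey distrC ger0_norm; last first.
  by rewrite subr_ge0 lerXn2r ?nnegrE ?expR_ge0// subr_ge0.
apply: le_trans (pow_diff_le _ _ _ _) _ => //; first by rewrite subr_ge0.
apply: (@le_trans _ _ (n%:R * y ^+ 2)); first by rewrite ler_pM2l//; lra.
by rewrite le_eqVlt; apply/orP; left; apply/eqP; rewrite /y; field; rewrite gt_eqF.
Qed.

Lemma pow_gumbel_eqO (tau : nat -> R) x : tau n @[n --> \oo] --> x ->
  (fun n => (1 - expR (- tau n) / n%:R) ^+ n - gumbel (tau n))
    =O_\oo (fun n : nat => n%:R^-1 : R).
Proof.
move=> taux.
have ztau : expR (- tau n) @[n --> \oo] --> expR (- x).
  apply: (@cvg_comp _ _ _ (fun n => - tau n) expR); first exact: cvgN taux.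
  exact: continuous_expR.
pose B := expR (- x) + 1.
apply/eqO_exP; exists (B ^+ 2); first by rewrite exprn_gt0// ltr_wpDl// expR_ge0.
near=> n.
have n0 : (0 < n)%N by near: n; exact: nbhs_infty_gt.
have zB : expR (- tau n) <= B.
  by near: n; apply: (cvgr_le _ ztau); rewrite ltrDl.
have zn : B <= n%:R by near: n; move/cvgryPge: (@cvgr_idn R); exact.
have z0 := expR_ge0 (- tau n).
apply: le_trans (pow_expR_bound n0 _) _; first by rewrite z0 (le_trans zB).
rewrite ger0_norm ?invr_ge0// ler_wpM2r ?invr_ge0//.
by rewrite lerXn2r ?nnegrE// (le_trans z0).
Unshelve. all: by end_near. Qed.

Lemma is_derive_gumbel x : is_derive x 1 (@gumbel R) (gumbel x * expR (- x)).
Proof.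
rewrite (_ : @gumbel R = expR \o (fun t => - expR (- t)))//.
by apply: is_derive_eq; rewrite /= mulrN1 opprK.
Qed.

(** Writing the increment of the Gumbel function as its differential times
    [1 + e n] is the definition of the derivative; where [tau n = x] both sides
    vanish and [e n] is set to [0]. *)
Lemma gumbel_first_order (tau : nat -> R) x : tau n @[n --> \oo] --> x ->
  exists2 e : nat -> R, e n @[n --> \oo] --> (0 : R) &
    forall n, gumbel (tau n) - gumbel x =
      gumbel x * expR (- x) * (tau n - x) * (1 + e n).
Proof.
move=> taux.
pose g := gumbel x * expR (- x).
have g0 : 0 < g by rewrite mulr_gt0 ?expR_gt0.
exists (fun n => if tau n == x then 0
          else (gumbel (tau n) - gumbel x - g * (tau n - x)) / (g * (tau n - x))).
  apply/cvgr0Pnorm_le => eps e0.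
  have [r /= r0 Hr] := taylor1_peano (is_derive_gumbel x) (mulr_gt0 e0 g0).
  have /cvgrPdist_lt/(_ _ r0) := taux; apply: filterS => n; rewrite distrC => tn.
  case: eqP => [_|/eqP tnx]; first by rewrite normr0 ltW.
  have h0 : 0 < `|tau n - x| by rewrite normr_gt0 subr_eq0.
  have := Hr (tau n - x); rewrite /= sub0r normrN => /(_ tn).
  rewrite subrKC -/g => H.
  by rewrite normf_div normrM (gtr0_norm g0) ler_pdivrMr ?(mulr_gt0 g0 h0)// mulrA.
move=> n; case: eqP => [->|/eqP tnx]; first by rewrite !subrr mulr0 mul0r.
rewrite -/g; field.
by rewrite subr_eq0 tnx gt_eqF.
Qed.

Lemma gumbel_continuous : continuous (@gumbel R).
Proof.
move=> x; apply: differentiable_continuous; apply/derivable1_diffP.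
by have [] := is_derive_gumbel x.
Qed.

End gumbel_approximation.

(** * Tails along the normalizing sequences *)

(** Reads a negative log-tail [h] at the level [ln N] as a tail probability
    in units of [1 / N]. *)
Lemma expR_sub_ln (R : realType) (h N : R) : 0 < N ->
  expR (- (h - ln N)) / N = expR (- h).
Proof. by move=> N0; rewrite opprB expRB lnK// expRN mulrC mulKf// gt_eqF. Qed.

Section tail.
Variables (R : realType) (p c alpha : R) (l : R -> R).
Variable F : cumulativeBounded (0 : R) (1 : R).
Hypotheses (p_gt0 : 0 < p) (c_gt0 : 0 < c)
  (l_nsv : normalized_slowly_varying l)
  (F_Rplus : forall x : R, x < 0 -> F x = 0)
  (F_tail : \forall x \near +oo%R,
     1 - F x = l x * x `^ alpha * expR (- (c * x `^ p))).
Notation L := (fun x => ln (l x)).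
Notation H := (neglog_tail p c alpha L).

Let L_slow : log_slow L.
Proof. by have [] := nsv_log_slow l_nsv. Qed.

Lemma tail_neglog : \forall x \near +oo, 1 - F x = expR (- H x).
Proof.
have [l_gt0 _] := nsv_log_slow l_nsv.
near=> x.
have x0 : 0 < x by near: x; apply: nbhs_pinfty_gt; exact: num_real.
have lx0 : 0 < l x by near: x.
have -> : 1 - F x = l x * x `^ alpha * expR (- (c * x `^ p)) by near: x.
rewrite -{1}(lnK lx0) -[X in _ * X * _]lnK ?posrE ?powR_gt0// ln_powR -!expRD.
by congr expR; rewrite /neglog_tail; ring.
Unshelve. all: by end_near. Qed.

Lemma tail_lt1 : \forall x \near +oo, F x < 1.
Proof.
by apply: filterS tail_neglog => x E; rewrite -subr_gt0 E expR_gt0.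
Qed.

Lemma tail_continuous : \forall x \near +oo, {for x, continuous F}.
Proof.
have [M [_ HM]] := tail_neglog.
have Lc := log_slow_continuous L_slow.
near=> x.
have x0 : 0 < x by near: x; apply: nbhs_pinfty_gt; exact: num_real.
have Mx : M < x by near: x; apply: nbhs_pinfty_gt; exact: num_real.
have Lx : {for x, continuous L} by near: x.
have Hx : H y @[y --> x] --> H x.
  apply: cvgB Lx; apply: cvgB; apply: cvgMl_tmp; last exact: continuous_ln.
  have : {for x, continuous ((@powR R) ^~ p)}.
    apply: differentiable_continuous; apply/derivable1_diffP.
    by apply: derivable_powR; rewrite in_itv/= x0.
  exact.
have Ex : 1 - expR (- H y) @[y --> x] --> 1 - expR (- H x).
  apply: cvgB; first exact: cvg_cst.
  apply: (@cvg_comp _ _ _ (fun y => - H y) expR); first exact: cvgN Hx.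
  exact: continuous_expR.
have FE y : M < y -> F y = 1 - expR (- H y) by move=> /HM /= <-; ring.
rewrite /prop_for/= /continuous_at (FE x Mx); apply: cvg_trans Ex.
apply: near_eq_cvg.
have : \forall y \near x, M < y by exact: (cvgr_gt x cvg_id).
by apply: filterS => y /FE.
Unshelve. all: by end_near. Qed.

(** The quantile [b_n] solves [1 - F b = 1 / n] exactly, by continuity. *)
Lemma neglog_loc_b : \forall n \near \oo, H (loc_b F n) = ln n%:R.
Proof.
have b_tail := loc_b_cvgy tail_lt1 tail_neglog.
near=> n.
have n0 : (0 < n)%N by near: n; exact: nbhs_infty_gt.
have Fb : F (loc_b F n) = 1 - n%:R^-1.
  by near: n; exact: cdf_loc_b tail_lt1 F_Rplus tail_continuous.
have Eb : 1 - F (loc_b F n) = expR (- H (loc_b F n)) by near: n.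
have : expR (- H (loc_b F n)) = n%:R^-1 by rewrite -Eb Fb; ring.
move=> /(congr1 (@ln R)); rewrite expRK lnV ?posrE ?ltr0n// => /eqP.
by rewrite eqr_opp => /eqP.
Unshelve. all: by end_near. Qed.

Lemma cvg_along_loc_b (f : R -> R) (y : R) : f u @[u --> +oo] --> y ->
  f (loc_b F n) @[n --> \oo] --> y.
Proof. exact: (cvg_comp _ _ (loc_b_cvgy tail_lt1)). Qed.

Section fixed_argument.
Variable x : R.
Notation b := (loc_b F).
Notation gamma n := (gamma_n p c F n x).

Let sx2 : rel_scale p c u * x ^+ 2 @[u --> +oo] --> (0 : R).
Proof. by rewrite -(mul0r (x ^+ 2)); apply: cvgMr_tmp; exact: rel_scale_cvg0. Qed.

Let v_cvgy : b n + scale_a p c F n * x @[n --> \oo] --> +oo.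
Proof.
have [vy _] := neglog_tail_shift alpha p_gt0 c_gt0 L_slow sx2.
exact: (cvg_comp _ _ (loc_b_cvgy tail_lt1) vy).
Qed.

Lemma gamma_neglog : \forall n \near \oo,
  gamma n = H (b n + aux_f p c (b n) * x) - H (b n).
Proof.
have v_tail := v_cvgy tail_neglog.
have b_tail := loc_b_cvgy tail_lt1 tail_neglog.
near=> n; rewrite /gamma_n.
have -> : 1 - F (b n) = expR (- H (b n)) by near: n.
have -> : 1 - F (b n + scale_a p c F n * x) =
    expR (- H (b n + scale_a p c F n * x)) by near: n.
by rewrite -expRB expRK /scale_a; ring.
Unshelve. all: by end_near. Qed.

Lemma gamma_cvg : gamma n @[n --> \oo] --> x.
Proof.
have [_ /cvg_along_loc_b] := neglog_tail_shift alpha p_gt0 c_gt0 L_slow sx2.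
move=> /(cvgD (cvg_cst x)); rewrite addr0; apply: cvg_trans.
apply: near_eq_cvg; apply: filterS gamma_neglog => n ->.
rewrite fctE; ring.
Qed.

(** The expansion produces [s (b_n)] as the unit of the correction; it may be
    replaced by [(p * ln n)^-1] because [ln n] is the negative log-tail at
    [b_n] and [p * s u * H u -> 1]. *)
Lemma gamma_second_order : exists e : nat -> R,
  e n @[n --> \oo] --> (0 : R) /\
  \forall n \near \oo, gamma n - x =
    ((p - 1) * x ^+ 2 / 2 - alpha * x + e n) * (p * ln n%:R)^-1.
Proof.
pose T := (p - 1) * x ^+ 2 / 2 - alpha * x.
exists (fun n => (gamma n - x) * (p * ln n%:R) - T); split; last first.
  near=> n.
  have n1 : (1 < n)%N by near: n; exact: nbhs_infty_gt.
  by rewrite -/T subrKC mulfK// mulf_eq0 negb_or !gt_eqF// ln_gt0// ltr1n.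
have h2 := cvg_along_loc_b (neglog_tail_shift_second_order
  (alpha := alpha) p_gt0 c_gt0 L_slow (x := x)).
have h1 := cvg_along_loc_b (rel_scale_neglog_cvg1 alpha p_gt0 c_gt0 L_slow).
have h3 : (H (b n + aux_f p c (b n) * x) - H (b n) - x) / rel_scale p c (b n) *
    (p * rel_scale p c (b n) * H (b n)) - T @[n --> \oo] --> (0 : R).
  rewrite [X in _ --> X](_ : _ = ((p - 1) / 2 * x ^+ 2 - alpha * x) * 1 - T).
    by apply: cvgB; [exact: cvgM h2 h1|exact: cvg_cst].
  by rewrite /T; ring.
apply: cvg_trans h3; apply: near_eq_cvg.
have b_gt0 : \forall n \near \oo, 0 < b n.
  by have /cvgryPgt := loc_b_cvgy tail_lt1; exact.
near=> n.
have -> : gamma n = H (b n + aux_f p c (b n) * x) - H (b n).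
  by near: n; exact: gamma_neglog.
have <- : H (b n) = ln n%:R by near: n; exact: neglog_loc_b.
have s0 : 0 < rel_scale p c (b n) by apply: rel_scale_gt0 => //; near: n.
by rewrite /=; field; rewrite gt_eqF.
Unshelve. all: by end_near. Qed.

Lemma cdf_pow_gamma : \forall n \near \oo,
  F (b n + scale_a p c F n * x) ^+ n = (1 - expR (- gamma n) / n%:R) ^+ n.
Proof.
have v_tail := v_cvgy tail_neglog.
near=> n.
have n0 : (0 < n)%N by near: n; exact: nbhs_infty_gt.
have vE : 1 - F (b n + scale_a p c F n * x) =
    expR (- H (b n + scale_a p c F n * x)) by near: n.
have -> : gamma n = H (b n + aux_f p c (b n) * x) - H (b n).
  by near: n; exact: gamma_neglog.
have -> : H (b n) = ln n%:R by near: n; exact: neglog_loc_b.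
congr (_ ^+ _); rewrite -[F _](subKr 1) vE; congr (_ - _).
by rewrite expR_sub_ln ?ltr0n.
Unshelve. all: by end_near. Qed.

End fixed_argument.

Section tilde.
Variable x : R.
Let u (n : nat) : R := (c^-1 * ln n%:R) `^ p^-1.
Notation K u := (alpha * ln u + L u).

Lemma ln_nat_cvgy : ln (n%:R : R) @[n --> \oo] --> +oo.
Proof.
apply/cvgryPge => A; near=> n.
have An : expR A <= n%:R by near: n; move/cvgryPge: (@cvgr_idn R); exact.
by rewrite -(expRK A) ler_ln// posrE ?expR_gt0// (lt_le_trans (expR_gt0 A)).
Unshelve. all: by end_near. Qed.

Let u_cvgy : u n @[n --> \oo] --> +oo.
Proof.
have ip : 0 < p^-1 by rewrite invr_gt0.
apply: (cvg_comp _ _ _ (powR_cvgy ip)).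
apply/cvgryPge => A; move/cvgryPge/(_ (c * A)) : ln_nat_cvgy.
by apply: filterS => n; rewrite ler_pdivlMl.
Qed.

(** The centring constant is a first Newton-like correction of [u n]: solving
    [H u' = ln n] from [u n], where [H] falls short of [ln n] by [K (u n)],
    moves the point by [aux_f p c (u n) * K (u n)]. *)
Lemma tilde_constantsE : \forall n \near \oo,
  scale_a_tilde p c n * x + loc_b_tilde p c alpha l n =
  u n + aux_f p c (u n) * (x + K (u n)).
Proof.
near=> n.
have n1 : (1 < n)%N by near: n; exact: nbhs_infty_gt.
have y0 : 0 < c^-1 * ln n%:R :> R by rewrite mulr_gt0 ?invr_gt0// ln_gt0 ?ltr1n.
rewrite /scale_a_tilde /loc_b_tilde /aux_f /u; set y := c^-1 * _ in y0 *.
have -> : (y `^ p^-1) `^ (1 - p) = y `^ (p^-1 - 1).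
  by rewrite -powRrM; congr (_ `^ _); field; rewrite gt_eqF.
by rewrite ln_powR; field; rewrite !gt_eqF.
Unshelve. all: by end_near. Qed.

(** The shift by [K (u n)] raises the negative log-tail by [K (u n) + o(1)],
    which compensates for [H (u n) = ln n - K (u n)]. *)
Lemma cdf_pow_tilde : exists2 tau : nat -> R, tau n @[n --> \oo] --> x &
  \forall n \near \oo,
    F (scale_a_tilde p c n * x + loc_b_tilde p c alpha l n) ^+ n =
    (1 - expR (- tau n) / n%:R) ^+ n.
Proof.
have [vy vH] := neglog_tail_shift alpha p_gt0 c_gt0 L_slow
  (rel_scale_log_sq_cvg0 alpha p_gt0 c_gt0 L_slow x).
pose v u := u + aux_f p c u * (x + K u).
exists (fun n => x + (H (v (u n)) - H (u n) - (x + K (u n)))).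
  rewrite -[X in _ --> X]addr0; apply: cvgD; first exact: cvg_cst.
  exact: (cvg_comp _ _ u_cvgy vH).
have v_cvgy := cvg_comp _ _ u_cvgy vy.
have v_tail := v_cvgy _ tail_neglog.
near=> n.
have n0 : (0 < n)%N by near: n; exact: nbhs_infty_gt.
have -> : scale_a_tilde p c n * x + loc_b_tilde p c alpha l n = v (u n).
  by near: n; exact: tilde_constantsE.
have vE : 1 - F (v (u n)) = expR (- H (v (u n))) by near: n.
have y0 : 0 <= c^-1 * ln n%:R :> R.
  by rewrite mulr_ge0 ?invr_ge0 ?(ltW c_gt0)// ln_ge0// ler1n.
have Hu : H (u n) = ln n%:R - K (u n).
  rewrite /neglog_tail /u -powRrM mulVf ?gt_eqF// powRr1// mulrA divff ?gt_eqF//.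
  by rewrite mul1r; ring.
congr (_ ^+ _); rewrite -[F _](subKr 1) vE; congr (_ - _).
have -> : x + (H (v (u n)) - H (u n) - (x + K (u n))) = H (v (u n)) - ln n%:R.
  by rewrite Hu; ring.
by rewrite expR_sub_ln ?ltr0n.
Unshelve. all: by end_near. Qed.

End tilde.

End tail.

(** * The extreme value expansion *)

Theorem proposition3 (R : realType) (p c alpha : R) (l : R -> R)
    (F : cumulativeBounded (0 : R) (1 : R))
    (d : measure_display) (T : measurableType d) (P : probability T R)
    (X : nat -> {RV P >-> R})
    (p_gt0 : 0 < p) (c_gt0 : 0 < c)
    (l_nsv : normalized_slowly_varying l)
    (F_Rplus : forall x : R, x < 0 -> F x = 0)
    (F_ac : abs_continuous_near_infty F)
    (F_tail : \forall x \near +oo%R,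
       1 - F x = l x * x `^ alpha * expR (- (c * x `^ p)))
    (X_iid : iid_with_cdf X F) :
  (forall x : R,
     (exists e r : nat -> R,
        [/\ e n @[n --> \oo] --> (0 : R),
            r =O_\oo (fun n : nat => n%:R^-1 : R) &
            \forall n \near \oo,
              cdf_max X n (scale_a p c F n * x + loc_b F n) - gumbel x =
              gumbel x * expR (- x) * (gamma_n p c F n x - x) * (1 + e n)
              + r n]) /\
     (exists e : nat -> R,
        e n @[n --> \oo] --> (0 : R) /\
        \forall n \near \oo,
          gamma_n p c F n x - x =
          ((p - 1) * x ^+ 2 / 2 - alpha * x + e n) * (p * ln n%:R)^-1)) /\
  (forall x : R,
     cdf_max X n (scale_a_tilde p c n * x + loc_b_tilde p c alpha l n)
       @[n --> \oo] --> gumbel x).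
Proof.
split=> x; last first.
  have [tau tau_x FE] := cdf_pow_tilde p_gt0 c_gt0 l_nsv F_tail x.
  have /eqO_exP[k k0 rk] := pow_gumbel_eqO tau_x.
  have r0 : (1 - expR (- tau n) / n%:R) ^+ n - gumbel (tau n)
      @[n --> \oo] --> (0 : R).
    apply: cvg0_le rk _; rewrite -[X in _ --> X](mulr0 k); apply: cvgMl_tmp.
    apply/norm_cvg0P/gtr0_cvgV0; last exact: cvgr_idn.
    by near=> n; rewrite ltr0n; near: n; exact: nbhs_infty_gt.
  have gx : gumbel (tau n) @[n --> \oo] --> gumbel x.
    by apply: (cvg_comp _ _ tau_x); exact: gumbel_continuous.
  have : (1 - expR (- tau n) / n%:R) ^+ n - gumbel (tau n) + gumbel (tau n)
      @[n --> \oo] --> gumbel x.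
    by rewrite -[X in _ --> X]add0r; exact: cvgD r0 gx.
  apply: cvg_trans; apply: near_eq_cvg; near=> n.
  rewrite subrK (cdf_max_pow _ X_iid); last by near: n; exact: nbhs_infty_gt.
  by near: n; apply: filterS FE => n ->.
split; last exact: (gamma_second_order p_gt0 c_gt0 l_nsv F_Rplus F_tail).
have gx : gamma_n p c F n x @[n --> \oo] --> x.
  exact: (gamma_cvg p_gt0 c_gt0 l_nsv F_tail).
have [e e0 eE] := gumbel_first_order gx.
exists e, (fun n => (1 - expR (- gamma_n p c F n x) / n%:R) ^+ n
                    - gumbel (gamma_n p c F n x)).
split=> //; first exact: (pow_gumbel_eqO gx).
near=> n.
rewrite (cdf_max_pow _ X_iid); last by near: n; exact: nbhs_infty_gt.
rewrite -eE.
have -> : F (scale_a p c F n * x + loc_b F n) ^+ n =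
    (1 - expR (- gamma_n p c F n x) / n%:R) ^+ n.
  rewrite [_ * x + _]addrC; near: n.
  exact: (cdf_pow_gamma p_gt0 c_gt0 l_nsv F_Rplus F_tail).
by ring.
Unshelve. all: by end_near. Qed.
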